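(* Let $X$ be a smooth projective toric variety, let $\{h_1,\dots,h_N\}$ be the Hilbert basis of $\mathrm{Nef}(X)\cap\mathrm{Pic}(X)$, and let $0\ne D\in\mathrm{Nef}(X)\cap\mathrm{Pic}(X)$. Then $$\tau_X(D;\mathbb Z)=\max\Big\{\sum_{j=1}^Nz_j\ \Big|\ \sum_{j=1}^Nz_jh_j=D,\ z=(z_1,\dots,z_N)\in\mathbb Z_{\ge0}^N\Big\},$$ $$\tau_X(D;\mathbb Q)=\max\Big\{\sum_{j=1}^Nx_j\ \Big|\ \sum_{j=1}^Nx_jh_j=D,\ x=(x_1,\dots,x_N)\in\mathbb Q_{\ge0}^N\Big\}.$$ In particular, the suprema defining $\tau_X(D;\mathbb Z)$ and $\tau_X(D;\mathbb Q)$ are maxima.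
   Context: All toric varieties are over an algebraically closed field. Gongyo indices. For a smooth projective toric variety $X$, a nonzero class $D\in\mathrm{Nef}(X)\cap\mathrm{Pic}(X)$ and $\mathbb K\in\{\mathbb Z,\mathbb Q\}$, put $$\tau_X(D;\mathbb K)=\sup\Big\{\sum_{i=1}^r a_i\ \Big|\ D=\sum_{i=1}^r a_iD_i,\ 0\ne D_i\in\mathrm{Nef}(X)\cap\mathrm{Pic}(X),\ a_i\in\mathbb K_{>0}\Big\}$$ (for $\mathbb K=\mathbb Q$ the equality is in $\mathrm{Pic}(X)\otimes\mathbb Q$). Hilbert basis. For a lattice $L$ and a strongly convex rational polyhedral cone $C\subset L_{\mathbb R}$, the Hilbert basis of $\Gamma=C\cap L$ is the unique minimal finite generating set of the monoid $\Gamma$, equivalently the set of $h\in\Gamma\setminus\{0\}$ that are not of the form $u+v$ with $u,v\in\Gamma\setminus\{0\}$. Here $C=\mathrm{Nef}(X)$ and $L=\mathrm{Pic}(X)$. *)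

(* Defs.v *)
From HB Require Import structures.
From mathcomp Require Import all_boot all_order all_algebra.
From mathcomp Require Import all_classical all_reals all_analysis.

Set Implicit Arguments.
Unset Strict Implicit.
Unset Printing Implicit Defensive.

Import Order.TTheory GRing.Theory Num.Theory.

Local Open Scope ring_scope.
Local Open Scope quotient_scope.

(** * Toric varieties

    A smooth toric variety is given by its fan in N = Z^n (row vectors; the
    dual lattice M is again Z^n).  Smooth cones are simplicial, so a cone of
    the fan is recorded by the set of (indices of) its rays.  The base field
    plays no role in Pic, in intersection numbers or in Nef. *)

Record fan (n : nat) := Fan {
  nrays : nat;
  ray : 'I_nrays -> 'rV[int]_n;
  cones : {set {set 'I_nrays}}
}.

Section Toric.
Variables (n : nat) (X : fan n).

Definition pairing (m u : 'rV[int]_n) : int := \sum_j m 0 j * u 0 j.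

(* The cones live in N_Q; since they are rational polyhedral, the conditions
   below are equivalent to the same conditions in N_R. *)
Definition in_cone (s : {set 'I_(nrays X)}) (x : 'rV[rat]_n) : Prop :=
  exists c : 'I_(nrays X) -> rat,
    (forall i, 0 <= c i) /\
    x = \sum_(i in s) c i *: map_mx intr (ray i).

Definition smooth_cone (s : {set 'I_(nrays X)}) : Prop :=
  exists (B : 'M[int]_n) (f : 'I_(nrays X) -> 'I_n),
    [/\ B \in unitmx, {in s &, injective f} &
        {in s, forall i, row (f i) B = ray i}].

(* Because all cones are smooth, the faces of the cone over s are the cones
   over the subsets of s. *)
Record smooth_fan : Prop := SmoothFan {
  fan_smooth : forall s : {set 'I_(nrays X)},
    s \in cones X -> smooth_cone s;
  fan_ray : forall i, [set i] \in cones X;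
  fan_face : forall s t : {set 'I_(nrays X)},
    s \in cones X -> t \subset s -> t \in cones X;
  fan_inter : forall (s t : {set 'I_(nrays X)}) x,
    s \in cones X -> t \in cones X ->
    in_cone s x -> in_cone t x -> in_cone (s :&: t) x
}.

Definition complete_fan : Prop :=
  forall x : 'rV[rat]_n, exists2 s : {set 'I_(nrays X)}, s \in cones X & in_cone s x.

(* Torus-invariant divisors sum_i (D 0 i) D_i. *)
Local Notation divisor := 'rV[int]_(nrays X).

(* D has a strictly convex support function, i.e. the fan is the normal fan of
   the polytope of D; m s is the character which is the Cartier datum of D on
   the affine chart of the maximal cone s. *)
Definition ample_divisor (D : divisor) : Prop :=
  exists m : {set 'I_(nrays X)} -> 'rV[int]_n,
    forall s : {set 'I_(nrays X)}, s \in cones X -> #|s| = n -> forall i,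
      if i \in s then pairing (m s) (ray i) = - D 0 i
      else - D 0 i < pairing (m s) (ray i).

Definition smooth_projective : Prop :=
  [/\ smooth_fan, complete_fan & exists D : divisor, ample_divisor D].

(** ** The Picard group *)

(* The divisor of the character chi^m. *)
Definition div_char (m : 'rV[int]_n) : divisor :=
  \row_i pairing m (ray i).

Definition principal : {pred divisor} :=
  fun D => `[< exists m, D = div_char m >].

Lemma principal_zmod_closed : zmod_closed principal.
Proof.
split; first apply/asboolP.
  exists 0; apply/rowP => i; rewrite !mxE /pairing big1 // => j _.
  by rewrite mxE mul0r.
move=> D E /asboolP[m ->] /asboolP[m' ->]; apply/asboolP.
exists (m - m'); apply/rowP => i; rewrite !mxE /pairing -sumrB.
by apply: eq_bigr => j _; rewrite !mxE mulrBl.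
Qed.

HB.instance Definition _ :=
  GRing.isZmodClosed.Build divisor principal principal_zmod_closed.

(* Divisors modulo divisors of characters: this is Cl(X), which is Pic(X) since
   X is smooth. *)
Definition Pic : zmodType := @Quotient.quot divisor principal.

(** ** Nef classes *)

(* c is the vector of intersection numbers D_i . V(t) of the boundary divisors
   with the torus-invariant curve V(t), where t is a wall, i.e. an
   (n-1)-dimensional cone, with adjacent maximal cones t + rho, t + rho'.  On a
   smooth complete toric variety, D_rho . V(t) = D_rho' . V(t) = 1, the divisors
   D_i with i outside t + rho + rho' do not meet V(t), and the remaining numbers
   are determined by the wall relation sum_i (D_i . V(t)) u_i = 0. *)
Definition curve_class (t : {set 'I_(nrays X)}) (c : 'rV[int]_(nrays X)) :
    Prop :=
  exists rho rho' : 'I_(nrays X),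
    [/\ [/\ #|t|.+1 = n, rho \notin t, rho' \notin t & rho != rho'],
        rho |: t \in cones X /\ rho' |: t \in cones X,
        c 0 rho = 1 /\ c 0 rho' = 1,
        forall i, i \notin rho |: (rho' |: t) -> c 0 i = 0 &
        \sum_i c 0 i *: ray i = 0].

Definition intersection_number (D c : 'rV[int]_(nrays X)) : int :=
  \sum_i D 0 i * c 0 i.

Definition nef_divisor (D : divisor) : Prop :=
  forall t c, curve_class t c -> 0 <= intersection_number D c.

(* Nef(X) `&` Pic(X); see [nef_pi] for the independence of the representative. *)
Definition nef : set Pic := [set D | nef_divisor (repr D)].

Lemma intersection_div_char m t c :
  curve_class t c -> intersection_number (div_char m) c = 0.
Proof.
move=> [rho [rho' [_ _ _ _ rel]]].
transitivity (pairing m (\sum_i c 0 i *: ray i)); last first.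
  by rewrite rel /pairing big1 // => j _; rewrite mxE mulr0.
rewrite /intersection_number /pairing.
under [RHS]eq_bigr => j _ do rewrite summxE mulr_sumr.
rewrite exchange_big; apply: eq_bigr => i _; rewrite mxE /pairing mulr_suml.
by apply: eq_bigr => j _; rewrite mxE -mulrA [c 0 i * _]mulrC.
Qed.

Lemma nef_pi (D : divisor) :
  nef (\pi_(Quotient.quot principal) D) <-> nef_divisor D.
Proof.
have /eqP/eqP : repr (\pi_(Quotient.quot principal) D) == D
    %[mod Quotient.quot principal] by rewrite reprK.
set E := repr _ => EE; have: E - D \in (principal : {pred _}).
  by rewrite Quotient.idealrBE EE.
move=> /asboolP[m Em].
have eq_int t c : curve_class t c ->
    intersection_number E c = intersection_number D c.
  move=> tc; apply/eqP; rewrite -subr_eq0; apply/eqP.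
  rewrite -[RHS](intersection_div_char m tc) -Em /intersection_number -sumrB.
  by apply: eq_bigr => i _; rewrite !mxE mulrBl.
by split=> H t c tc; move: (H t c tc); rewrite (eq_int t c).
Qed.

End Toric.

(** * Hilbert bases *)

Definition hilbert_basis (V : zmodType) (G : set V) : set V :=
  [set h | [/\ G h, h <> 0 &
    forall u v, G u -> G v -> u <> 0 -> v <> 0 -> h <> u + v]].

(** * Gongyo indices *)

(* D (x) 1 = \sum_i E_i (x) a_i in V (x) Q, seen as the localization of V at the
   nonzero integers: the a_i are brought to a common denominator k, which may be
   enlarged so as to kill torsion. *)
Definition eq_tensor_rat (V : zmodType) (r : nat) (D : V)
    (a : 'I_r -> rat) (E : 'I_r -> V) : Prop :=
  exists (k : nat) (b : 'I_r -> int),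
    [/\ (0 < k)%N, forall i, (b i)%:~R = k%:R * a i &
        D *+ k = \sum_i E i *~ b i].

Section Gongyo.
Local Open Scope classical_set_scope.
Local Open Scope ereal_scope.
Variables (R : realType) (n : nat) (X : fan n) (D : Pic X).

Definition tau_int_set : set (\bar R) :=
  [set x | exists (r : nat) (a : 'I_r -> int) (E : 'I_r -> Pic X),
    [/\ forall i, nef (E i) /\ E i <> 0%R, forall i, (0 < a i)%R,
        D = (\sum_i E i *~ a i)%R & x = ((\sum_i a i)%R%:~R)%:E]].

Definition tau_rat_set : set (\bar R) :=
  [set x | exists (r : nat) (a : 'I_r -> rat) (E : 'I_r -> Pic X),
    [/\ forall i, nef (E i) /\ E i <> 0%R, forall i, (0 < a i)%R,
        eq_tensor_rat D a E & x = (ratr (\sum_i a i)%R)%:E]].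

Definition tau_int : \bar R := ereal_sup tau_int_set.
Definition tau_rat : \bar R := ereal_sup tau_rat_set.

Definition hilbert_int_set (N : nat) (h : 'I_N -> Pic X) : set (\bar R) :=
  [set x | exists z : 'I_N -> nat,
    (\sum_j h j *+ z j)%R = D /\ x = ((\sum_j z j)%N%:R)%:E].

Definition hilbert_rat_set (N : nat) (h : 'I_N -> Pic X) : set (\bar R) :=
  [set x | exists q : 'I_N -> rat,
    [/\ forall j, (0 <= q j)%R, eq_tensor_rat D q h &
        x = (ratr (\sum_j q j)%R)%:E]].

Definition is_max (A : set (\bar R)) (x : \bar R) : Prop :=
  A x /\ ubound A x.

End Gongyo.

Arguments tau_int_set R {n X} D.
Arguments tau_rat_set R {n X} D.
Arguments tau_int R {n X} D.
Arguments tau_rat R {n X} D.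
Arguments hilbert_int_set R {n X} D {N} h.
Arguments hilbert_rat_set R {n X} D {N} h.

(* Main.v *)
Require Import Defs.
From HB Require Import structures.
From mathcomp Require Import all_boot all_order all_algebra.
From mathcomp Require Import all_classical all_reals all_analysis.
From mathcomp Require Import ring zify.

Set Implicit Arguments.
Unset Strict Implicit.
Unset Printing Implicit Defensive.

Import Order.TTheory GRing.Theory Num.Theory.
Local Open Scope ring_scope.

(** The proof rests on one geometric fact: there is an additive degree
    [l : Pic X -> int] that is positive on every nonzero nef class
    ([nef_degree]).  Once it is available, the rest is about an arbitrary set
    [G] in an abelian group [V] carrying such a degree.

    Existence of the degree.  Fix a maximal cone [s]; since the fan is smooth,
    its rays form a basis of the lattice, so every class has a unique
    representative [D] whose coefficients on the rays of [s] vanish.  The degree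
    is the sum of the coefficients of this representative, and it has the
    required positivity as soon as these coefficients are nonnegative whenever
    the class is nef.  In invariant terms: the local equation [m] of a nef
    divisor [D] on the chart of [s] satisfies [<m, u_i> >= - D_i] for every ray
    [u_i] ([nef_globally_generated]).  This is proved by walking through the fan
    from [s] towards [u_i] as the simplex algorithm does.  If [u_i] is not in
    [s], some coordinate of [u_i] in the basis given by [s] is negative; crossing
    the wall opposite to that ray changes [<m, u_i>] by that coordinate times the
    degree of [D] on the curve of the wall, hence does not increase it.  The same
    computation for an ample divisor gives a strict decrease, so the walk ends.
    The existence of a cone on the other side of a wall, and of a maximal cone to
    start from, comes from completeness of the fan via [cone_star].

    Consequences of the degree.  By induction on it, every element of [G] is a
    nonnegative integral combination of the Hilbert basis
    ([hilbert_generates]).  Expanding the summands of a decomposition of [D] in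
    this way does not lower the sum of the coefficients, as a nonzero element
    needs at least one generator ([refine_int], [refine_rat]); conversely a
    decomposition over the Hilbert basis becomes one with positive coefficients
    when the zero terms are dropped.  So both sides of each formula have the
    same supremum, and it remains to see that the Hilbert side has a maximum.
    Over the integers the sums are bounded by [l D].  Over the rationals, this
    is linear programming on a bounded polyhedron: every feasible point is
    dominated by a vertex, and there are finitely many vertices since each one
    is determined by its support ([vertex_dominates], [hilbert_rat_max]). *)

(** * The pairing between characters and one-parameter subgroups *)

Section Pairing.
Variable n : nat.
Implicit Types (m u : 'rV[int]_n) (x y : 'rV[rat]_n).

Lemma pairingC m u : pairing m u = pairing u m.
Proof. by apply: eq_bigr => j _; rewrite mulrC. Qed.

Lemma pairingDr m u v : pairing m (u + v) = pairing m u + pairing m v.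
Proof.
by rewrite /pairing -big_split; apply: eq_bigr => j _; rewrite mxE mulrDr.
Qed.

Lemma pairingZr m a u : pairing m (a *: u) = a * pairing m u.
Proof.
by rewrite /pairing mulr_sumr; apply: eq_bigr => j _; rewrite mxE mulrCA.
Qed.

Lemma pairing0r m : pairing m 0 = 0.
Proof. by rewrite /pairing big1 // => j _; rewrite mxE mulr0. Qed.

Lemma pairing_sumr m (I : finType) (P : pred I) (F : I -> 'rV[int]_n) :
  pairing m (\sum_(i | P i) F i) = \sum_(i | P i) pairing m (F i).
Proof. exact: (big_morph _ (pairingDr m) (pairing0r m)). Qed.

Lemma pairing_suml u (I : finType) (P : pred I) (F : I -> 'rV[int]_n) :
  pairing (\sum_(i | P i) F i) u = \sum_(i | P i) pairing (F i) u.
Proof.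
by rewrite pairingC pairing_sumr; apply: eq_bigr => i _; rewrite pairingC.
Qed.

Lemma pairingDl m m' u : pairing (m + m') u = pairing m u + pairing m' u.
Proof. by rewrite ![pairing _ u]pairingC pairingDr. Qed.

Lemma pairingZl a m u : pairing (a *: m) u = a * pairing m u.
Proof. by rewrite ![pairing _ u]pairingC pairingZr. Qed.

Lemma pairingMnr m u k : pairing m (u *+ k) = pairing m u * k%:Z.
Proof. by rewrite -scaler_nat pairingZr natz mulrC. Qed.

Definition rat_vec u : 'rV[rat]_n := map_mx intr u.

Lemma rat_vecDMn u v k : rat_vec (u *+ k + v) = rat_vec u *+ k + rat_vec v.
Proof. by rewrite /rat_vec map_mxD raddfMn. Qed.

Definition rat_pairing m x : rat := \sum_j (m 0 j)%:~R * x 0 j.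

Lemma rat_pairing_vec m u : rat_pairing m (rat_vec u) = (pairing m u)%:~R.
Proof.
by rewrite /pairing rmorph_sum; apply: eq_bigr => j _; rewrite mxE rmorphM.
Qed.

Lemma rat_pairingD m x y :
  rat_pairing m (x + y) = rat_pairing m x + rat_pairing m y.
Proof.
by rewrite /rat_pairing -big_split; apply: eq_bigr => j _; rewrite mxE mulrDr.
Qed.

Lemma rat_pairing_comb m (I : finType) (P : pred I) (c : I -> rat)
    (u : I -> 'rV[int]_n) :
  rat_pairing m (\sum_(i | P i) c i *: rat_vec (u i)) =
  \sum_(i | P i) c i * (pairing m (u i))%:~R.
Proof.
have m0 : rat_pairing m 0 = 0.
  by rewrite /rat_pairing big1 // => j _; rewrite mxE mulr0.
rewrite (big_morph _ (rat_pairingD m) m0); apply: eq_bigr => i _.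
rewrite -rat_pairing_vec /rat_pairing mulr_sumr.
by apply: eq_bigr => j _; rewrite !mxE mulrCA.
Qed.

End Pairing.

(** * Cones of a smooth complete fan *)

Section ToricGeometry.
Variables (n : nat) (X : fan n).
Implicit Types (s t : {set 'I_(nrays X)}) (i j : 'I_(nrays X)).

Definition dual_system s (e : 'I_(nrays X) -> 'rV[int]_n) : Prop :=
  {in s &, forall i j, pairing (e i) (ray j) = (i == j)%:R}.

Lemma smooth_card s : smooth_cone s -> (#|s| <= n)%N.
Proof.
move=> [B [f [_ injf _]]].
by rewrite -(card_in_imset injf) -[X in (_ <= X)%N](card_ord n) max_card.
Qed.

Lemma pairing_inv_row (B : 'M[int]_n) a b : B \in unitmx ->
  pairing (row a (invmx B)^T) (row b B) = (b == a)%:R.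
Proof.
move=> uB; rewrite pairingC.
transitivity ((B *m invmx B) b a); last by rewrite mulmxV // mxE.
by rewrite [RHS]mxE; apply: eq_bigr => k _; rewrite !mxE.
Qed.

(** The rows of the unimodular matrix that extends the rays of a smooth cone have
    a dual basis, given by the columns of the inverse matrix.  When the cone is
    maximal these rows are all rays, and the dual basis reads off coordinates. *)
Lemma smooth_dual s : smooth_cone s ->
  exists2 e, dual_system s e &
    #|s| = n -> forall v, v = \sum_(j in s) pairing (e j) v *: ray j.
Proof.
move=> [B [f [uB injf rowf]]]; exists (fun i => row (f i) (invmx B)^T).
  move=> i j si sj /=; rewrite -(rowf j) // pairing_inv_row // eq_sym.
  by congr (nat_of_bool _)%:R; apply/eqP/eqP => [/injf->|->].
move=> card_s v.
have imf : f @: s = [set: 'I_n].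
  by apply/eqP; rewrite eqEcard finset.subsetT cardsT card_ord card_in_imset ?card_s /=.
transitivity (v *m invmx B *m B); first by rewrite mulmxKV.
rewrite mulmx_sum_row.
transitivity (\sum_(k in f @: s) (v *m invmx B) 0 k *: row k B).
  by rewrite imf; apply: eq_bigl => k; rewrite inE.
rewrite big_imset //=; apply: eq_bigr => j sj; rewrite rowf //.
congr (_ *: _); rewrite pairingC mxE; apply: eq_bigr => k _.
by rewrite !mxE.
Qed.

(** A row of the unimodular matrix which is not a ray of the cone, and the
    corresponding dual vector, witness that the cone does not span. *)
Lemma smooth_separate s : smooth_cone s -> (#|s| < n)%N ->
  exists e v : 'rV[int]_n,
    {in s, forall j, pairing e (ray j) = 0} /\ pairing e v = 1.
Proof.
move=> [B [f [uB injf rowf]]] card_s.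
have /subsetPn[k _ kP] : ~~ ([set: 'I_n] \subset f @: s).
  apply/negP => /subset_leq_card; rewrite cardsT card_ord.
  by rewrite card_in_imset // leqNgt card_s.
exists (row k (invmx B)^T), (row k B); split; last by rewrite pairing_inv_row ?eqxx.
move=> j sj; rewrite -rowf // pairing_inv_row //; case: eqP => // fj.
by rewrite -fj imset_f in kP.
Qed.

Lemma full_cone_agree s m m' : smooth_cone s -> #|s| = n ->
  {in s, forall j, pairing m (ray j) = pairing m' (ray j)} ->
  forall v, pairing m v = pairing m' v.
Proof.
move=> /smooth_dual[e _ /[apply] expand] eqm v; rewrite (expand v) !pairing_sumr.
by apply: eq_bigr => j sj; rewrite !pairingZr eqm.
Qed.

Hypothesis X_smooth : smooth_fan X.
Hypothesis X_complete : complete_fan X.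

Lemma eventually_nonneg (a b : int) :
  (forall K, exists2 k, (K <= k)%N & 0 <= a * k%:Z + b) -> 0 <= a.
Proof. by move=> /(_ `|b|.+1)[k]; nia. Qed.

Lemma neg_int_unit (a b : int) : b < 0 -> a * b = 1 -> b = -1.
Proof.
move=> b_lt0 ab1; have [|b_neq] := eqVneq b (-1); first by [].
have [a_ge0|a_lt0] := leP 0 a; nia.
Qed.

Lemma infinite_pigeonhole (T : finType) (f : nat -> T) :
  exists y, forall K, exists2 k, (K <= k)%N & f k = y.
Proof.
apply: contrapT => /forallNP noy.
have [g gP] : {g : T -> nat & forall y k, (g y <= k)%N -> f k <> y}.
  apply: (@choice _ _ (fun y K => forall k, (K <= k)%N -> f k <> y)) => y.
  have /existsNP[K /forall2NP KP] := noy y.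
  by exists K => k; case: (KP k).
by have := gP (f (\max_y g y)) (\max_y g y); apply; first exact: leq_bigmax.
Qed.

(** The points [k w + v], where [w] is the sum of the rays of [t], approach the
    direction of [w] from the side of [v].  One cone [s] contains infinitely many
    of them.  Their coordinates on [s] are affine in [k], so the limit direction
    [w] lies in [s] too; it lies in the relative interior of [t], and a cone of
    the fan that meets the relative interior of [t] has [t] as a face. *)
Lemma cone_star t v : t \in cones X ->
  exists s k, [/\ s \in cones X, t \subset s &
    in_cone s (rat_vec ((\sum_(j in t) ray j) *+ k + v))].
Proof.
move=> tX; set w := \sum_(j in t) ray j.
have [f fP] : {f : nat -> {set 'I_(nrays X)} & forall k,
    f k \in cones X /\ in_cone (f k) (rat_vec (w *+ k + v))}.
  apply: (@choice _ _ (fun k s => s \in cones X /\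
    in_cone s (rat_vec (w *+ k + v)))) => k.
  by have [s sX sk] := X_complete (rat_vec (w *+ k + v)); exists s.
have [s sP] := infinite_pigeonhole f.
have [k0 _ fk0] := sP 0; have [sX sk0] := fP k0; rewrite fk0 in sX sk0.
exists s, k0; split=> //.
have [e e_dual _] := smooth_dual (fan_smooth X_smooth sX).
(* On [s] the coordinates of a point are its pairings with the dual system. *)
have coord k : in_cone s (rat_vec (w *+ k + v)) ->
    {in s, forall i, 0 <= pairing (e i) w * k%:Z + pairing (e i) v} /\
    rat_vec (w *+ k + v) = \sum_(i in s)
      (pairing (e i) w * k%:Z + pairing (e i) v)%:~R *: rat_vec (ray i).
  move=> [c [c_ge0 cE]].
  have ceq i : i \in s ->
      c i = (pairing (e i) w * k%:Z + pairing (e i) v)%:~R.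
    move=> si; rewrite -pairingMnr -pairingDr -rat_pairing_vec cE.
    rewrite rat_pairing_comb (bigD1 i) //= e_dual // eqxx mulr1 big1 ?addr0 //.
    by move=> j /andP[sj ji]; rewrite e_dual // eq_sym (negPf ji) mulr0.
  split=> [i si|]; first by rewrite -(ler0z rat) -ceq.
  by rewrite cE; apply: eq_bigr => i si; rewrite ceq.
have [k1 k01 fk1] := sP k0.+1; have [_ sk1] := fP k1; rewrite fk1 in sk1.
have sw : in_cone s (rat_vec w).
  exists (fun i => if i \in s then (pairing (e i) w)%:~R else 0); split.
    move=> i; case: ifP => // si; rewrite ler0z.
    apply: (@eventually_nonneg _ (pairing (e i) v)) => K.
    have [k Kk fk] := sP K; exists k => //.
    by have [_] := fP k; rewrite fk => /coord[/(_ i si)].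
  have k1k0 : (k1%:R - k0%:R : rat) != 0.
    by rewrite subr_eq0 eqr_nat; apply/eqP; lia.
  apply: (scalerI k1k0).
  transitivity (rat_vec (w *+ k1 + v) - rat_vec (w *+ k0 + v)).
    by rewrite scalerBl !scaler_nat !rat_vecDMn opprD addrACA subrr addr0.
  rewrite (coord k1 sk1).2 (coord k0 sk0).2 -sumrB scaler_sumr.
  apply: eq_bigr => i ->; rewrite -scalerBl scalerA; congr (_ *: _).
  rewrite !rmorphD !rmorphM /= -!pmulrn opprD addrACA subrr addr0 mulrBl.
  by rewrite ![_ * (pairing _ _)%:~R]mulrC.
(* Intersecting, [w] is a combination of the rays in [t :&: s]; but its coordinate
   on each ray of [t] is [1]. *)
have tw : in_cone t (rat_vec w).
  exists (fun=> 1); split=> //.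
  rewrite /rat_vec map_mx_sum /=.
  by apply: eq_bigr => i _; rewrite scale1r.
have [c [_ cE]] := fan_inter X_smooth tX sX tw sw.
have [g g_dual _] := smooth_dual (fan_smooth X_smooth tX).
apply/fintype.subsetP => i ti; apply: contraT => nsi.
have := rat_pairing_vec (g i) w; rewrite cE rat_pairing_comb big1; last first.
  move=> j /setIP[tj sj]; rewrite g_dual //; case: eqP => [ij|_]; last by rewrite mulr0.
  by rewrite ij sj in nsi.
rewrite pairing_sumr (bigD1 i) //= g_dual // eqxx big1 ?addr0.
  by move/eqP; rewrite eq_sym oner_eq0.
by move=> j /andP[tj ji]; rewrite g_dual // eq_sym (negPf ji).
Qed.

(** The form of [cone_star] used for a cone [t] on which the character [e]
    vanishes: only the side on which [v] lies matters, and it is expressed by the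
    sign of [e] on the new rays. *)
Lemma cone_star_proper t e v : t \in cones X ->
  {in t, forall j, pairing e (ray j) = 0} -> pairing e v != 0 ->
  exists s, [/\ s \in cones X, t \proper s & exists2 c,
    forall i, 0 <= c i &
    (pairing e v)%:~R = \sum_(i in s) c i * (pairing e (ray i))%:~R :> rat].
Proof.
move=> tX et ev.
have [s [k [sX ts [c [c0 cE]]]]] := cone_star v tX.
have evE : (pairing e v)%:~R = \sum_(i in s) c i * (pairing e (ray i))%:~R :> rat.
  rewrite -rat_pairing_comb -cE rat_pairing_vec pairingDr.
  by rewrite pairingMnr pairing_sumr big1 // mul0r add0r.
exists s; split=> //; last by exists c.
rewrite finset.properEneq ts andbT; apply: contraNneq ev => tsE.
rewrite -(intr_eq0 rat) evE -tsE big1 // => j tj.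
by rewrite et // mulr0.
Qed.

Lemma full_cone_exists : exists2 s, s \in cones X & #|s| = n.
Proof.
have [s0 s0X _] := X_complete 0.
have [s sX smax] := @arg_maxnP _ s0 (fun s => s \in cones X) (fun s => #|s|) s0X.
exists s => //; have s_smooth := fan_smooth X_smooth sX.
apply/eqP; rewrite eqn_leq smooth_card //= leqNgt; apply/negP => sn.
have [e [v [es ev]]] := smooth_separate s_smooth sn.
have [|s' [s'X /proper_card ss' _]] := cone_star_proper (v := v) sX es.
  by rewrite ev.
by have := smax _ s'X; rewrite /= leqNgt ss'.
Qed.

(** The wall of [s] opposite to [rho] has a second maximal cone [rho' |: t] across
    it, found by moving from the wall in the direction [- ray rho].  The
    coordinate of [ray rho'] on [rho] is negative, and it is a unit because both
    cones are lattice bases, so it is [-1].  The wall relation is the expansion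
    of [ray rho'] in the basis of [s].  Adding to [D] the divisor of the character
    [m] does not change intersection numbers and leaves, among the rays that meet
    the curve, only the coefficient of [rho'], which gives the last formula. *)
Lemma wall_crossing s e rho : s \in cones X -> #|s| = n ->
  dual_system s e -> (forall v, v = \sum_(j in s) pairing (e j) v *: ray j) ->
  rho \in s ->
  exists rho' c, [/\ rho' \notin s, rho' |: (s :\ rho) \in cones X,
    pairing (e rho) (ray rho') = -1,
    curve_class (s :\ rho) c &
    forall (D : 'rV[int]_(nrays X)) m,
      {in s, forall j, pairing m (ray j) = - D 0 j} ->
      intersection_number D c = D 0 rho' + pairing m (ray rho')].
Proof.
move=> sX card_s e_dual expand srho; set t := s :\ rho.
have tX : t \in cones X by apply: (fan_face X_smooth sX); exact: finset.subsetDl.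
have card_t : #|t|.+1 = n by move: card_s; rewrite (cardsD1 rho s) srho.
have e_t : {in t, forall j, pairing (e rho) (ray j) = 0}.
  move=> j; rewrite !inE => /andP[jrho sj].
  by rewrite e_dual // eq_sym (negPf jrho).
have e_rho : pairing (e rho) (ray rho) = 1 by rewrite e_dual // eqxx.
have e_opp : pairing (e rho) (- ray rho) = -1.
  by rewrite -scaleN1r pairingZr e_rho mulr1.
have [|s' [s'X /properP[ts' [rho' s'rho' ntrho']] [a a_ge0 aE]]] :=
  cone_star_proper (v := - ray rho) tX e_t; first by rewrite e_opp.
have s'_smooth := fan_smooth X_smooth s'X.
have s'E : s' = rho' |: t.
  apply/esym/eqP; rewrite eqEcard finset.subUset finset.sub1set s'rho' ts' /=.
  by rewrite cardsU1 ntrho' add1n card_t smooth_card.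
have neg_rho' : pairing (e rho) (ray rho') < 0.
  move: aE; rewrite s'E big_setU1 //= big1 => [|j tj]; last by rewrite e_t ?mulr0.
  rewrite e_opp addr0 => aE; rewrite ltNge -(ler0z rat); apply/negP => pos.
  by have := mulr_ge0 (a_ge0 rho') pos; rewrite -aE.
have nsrho' : rho' \notin s.
  apply/negP => srho'; move: ntrho'; rewrite !inE srho' andbT negbK => /eqP rr.
  by rewrite rr e_rho in neg_rho'.
have e_rho' : pairing (e rho) (ray rho') = -1.
  (* Expand [ray rho] in the basis of [s'] and pair with [e rho]. *)
  have [e' _ expand'] := smooth_dual s'_smooth.
  have := congr1 (pairing (e rho)) (expand' _ (ray rho)).
  rewrite {1}s'E cardsU1 ntrho' add1n card_t => /(_ erefl).
  rewrite e_rho pairing_sumr s'E big_setU1 //= big1 => [|j tj].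
    rewrite addr0 pairingZr => /esym; exact: neg_int_unit.
  by rewrite pairingZr e_t ?mulr0.
pose c : 'rV[int]_(nrays X) :=
  \row_i ((i == rho')%:R - (if i \in s then pairing (e i) (ray rho') else 0)).
have c_rel : \sum_i c 0 i *: ray i = 0.
  under eq_bigr do rewrite mxE scalerBl.
  rewrite sumrB (bigD1 rho') //= eqxx scale1r big1 ?addr0; last first.
    by move=> i /negPf->; rewrite scale0r.
  rewrite [X in X - _](expand (ray rho')) [X in X - _]big_mkcond /= -sumrB.
  by rewrite big1 // => i _; case: ifP => _; rewrite ?scale0r subrr.
have c_rho' : c 0 rho' = 1 by rewrite mxE eqxx (negPf nsrho') subr0.
have c_out i : i \notin s -> i != rho' -> c 0 i = 0.
  by move=> /negPf si /negPf ir; rewrite mxE si ir subr0.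
exists rho', c; split=> //; first by rewrite -s'E.
  exists rho, rho'; split=> //.
  - by split=> //; [rewrite !inE eqxx | apply: contraNneq nsrho' => <-].
  - by rewrite -s'E finset.setD1K.
  - split=> //; rewrite mxE srho e_rho' opprK.
    by rewrite (_ : rho == rho' = false) ?add0r //; apply: contraNF nsrho' => /eqP<-.
  - move=> i; rewrite finset.setUCA finset.setD1K // !inE negb_or => /andP[ir si].
    exact: c_out.
move=> D m mD.
transitivity (\sum_i (D 0 i + pairing m (ray i)) * c 0 i).
  under [RHS]eq_bigr do rewrite mulrDl.
  rewrite big_split /= [X in _ + X](_ : _ = 0) ?addr0 //.
  rewrite -[RHS](pairing0r m) -c_rel pairing_sumr.
  by apply: eq_bigr => i _; rewrite pairingZr mulrC.
rewrite (bigD1 rho') //= c_rho' mulr1 big1 ?addr0 // => i ir.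
have [si|nsi] := boolP (i \in s); last by rewrite c_out ?mulr0.
by rewrite mD // subrr mul0r.
Qed.

(** Otherwise [ray i] would lie in the cones over [s] and over [[set i]], which
    meet only in the origin. *)
Lemma ray_outside s e i : s \in cones X ->
  (forall v, v = \sum_(j in s) pairing (e j) v *: ray j) ->
  i \notin s -> exists2 rho, rho \in s & pairing (e rho) (ray i) < 0.
Proof.
move=> sX expand nsi; apply: contrapT => /forall2NP pos.
have cone_s : in_cone s (rat_vec (ray i)).
  exists (fun j => if j \in s then (pairing (e j) (ray i))%:~R else 0); split.
    move=> j; case: ifP => // sj; rewrite ler0z leNgt; apply/negP.
    by case: (pos j) => //; rewrite sj.
  rewrite {1}(expand (ray i)) /rat_vec map_mx_sum.
  by apply: eq_bigr => j ->; rewrite map_mxZ.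
have cone_i : in_cone [set i] (rat_vec (ray i)).
  by exists (fun=> 1); split=> //; rewrite big_set1 scale1r.
have iX := fan_ray X_smooth i.
have [c [_]] := fan_inter X_smooth sX iX cone_s cone_i.
rewrite big1 => [zero|j]; last first.
  by rewrite !inE => /andP[sj /eqP ji]; rewrite ji (negPf nsi) in sj.
have [g g_dual _] := smooth_dual (fan_smooth X_smooth iX).
have := rat_pairing_vec (g i) (ray i); rewrite zero g_dual ?inE // eqxx.
rewrite /rat_pairing big1 => [/eqP|j _]; first by rewrite eq_sym oner_eq0.
by rewrite mxE mulr0.
Qed.

(** A nef divisor on a projective toric variety is globally generated: its local
    equations lie in its polytope.  The induction follows the walk from [s]
    towards [ray i], whose length is controlled by the value at [ray i] of the
    support data of the ample divisor [A]; this value is an integer bounded below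
    by [- A 0 i]. *)
Lemma nef_globally_generated (A D : 'rV[int]_(nrays X)) s m :
  ample_divisor A -> nef_divisor D -> s \in cones X -> #|s| = n ->
  {in s, forall j, pairing m (ray j) = - D 0 j} ->
  forall i, - D 0 i <= pairing m (ray i).
Proof.
move=> [mA mAP] D_nef sX card_s mD i.
have [k] := ubnP (absz (pairing (mA s) (ray i) + A 0 i)).
elim: k => // k IHk in s m sX card_s mD *; rewrite ltnS => le_k.
have [si|nsi] := boolP (i \in s); first by rewrite mD.
have [e e_dual /(_ card_s) expand] := smooth_dual (fan_smooth X_smooth sX).
have [rho srho rho_i] := ray_outside sX expand nsi.
have [rho' [c [nsrho' s'X e_rho' tc Dc]]] :=
  wall_crossing sX card_s e_dual expand srho.
set s' := rho' |: _ in s'X.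
have card_s' : #|s'| = n.
  rewrite cardsU1 in_setD1 (negPf nsrho') andbF.
  by move: card_s; rewrite (cardsD1 rho s) srho.
(* Passing to [s'] adds to a local equation the multiple of [e rho] by the
   intersection number with the curve of the wall. *)
have cross (E : 'rV[int]_(nrays X)) l :
    {in s, forall j, pairing l (ray j) = - E 0 j} ->
    {in s', forall j,
      pairing (l + intersection_number E c *: e rho) (ray j) = - E 0 j}.
  move=> lE j; rewrite pairingDl pairingZl (Dc _ _ lE) in_setU1 in_setD1.
  move=> /orP[/eqP->|/andP[jrho sj]]; first by rewrite e_rho'; ring.
  by rewrite e_dual // eq_sym (negPf jrho) mulr0 addr0 lE.
have mA_s : {in s, forall j, pairing (mA s) (ray j) = - A 0 j}.
  by move=> j sj; have := mAP s sX card_s j; rewrite sj.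
have Ac_gt0 : 0 < intersection_number A c.
  rewrite (Dc _ _ mA_s); have := mAP s sX card_s rho'; rewrite (negPf nsrho').
  by lia.
have mA_s' : pairing (mA s') (ray i) =
    pairing (mA s) (ray i) + intersection_number A c * pairing (e rho) (ray i).
  rewrite -pairingZl -pairingDl.
  apply: (full_cone_agree (fan_smooth X_smooth s'X) card_s') => j s'j.
  by rewrite cross //; have := mAP s' s'X card_s' j; rewrite s'j.
have mA_ge t : t \in cones X -> #|t| = n -> 0 <= pairing (mA t) (ray i) + A 0 i.
  by move=> tX card_t; have := mAP t tX card_t i; case: ifP => _; lia.
apply: (@le_trans _ _ (pairing (m + intersection_number D c *: e rho) (ray i))).
  apply: (IHk s') => //; first exact: cross.
  apply: leq_trans le_k; have := mA_ge s sX card_s; have := mA_ge s' s'X card_s'.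
  by rewrite mA_s'; nia.
rewrite pairingDl pairingZl gerDl.
by apply: mulr_ge0_le0; [exact: D_nef tc | exact: ltW].
Qed.

End ToricGeometry.

(** * A degree that is positive on nonzero nef classes *)

Section Degree.
Local Open Scope quotient_scope.
Variables (n : nat) (X : fan n).

(** The degree is the sum of the coefficients of the representative that vanishes
    on the rays of a fixed maximal cone.  If it is zero on a nef class, that
    representative is zero, and the class is trivial. *)
Lemma nef_degree : smooth_projective X ->
  exists l : {additive Pic X -> int}, forall x, nef x -> x <> 0 -> 0 < l x.
Proof.
move=> [X_smooth X_complete [A A_ample]].
have [s sX card_s] := full_cone_exists X_smooth X_complete.
have [e e_dual /(_ card_s) expand] := smooth_dual (fan_smooth X_smooth sX).
pose L (D : 'rV[int]_(nrays X)) :=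
  \sum_i (D 0 i - \sum_(j in s) D 0 j * pairing (e j) (ray i)).
have LB D E : L (D - E) = L D - L E.
  rewrite /L -sumrB; apply: eq_bigr => i _; rewrite !mxE.
  under eq_bigr do rewrite !mxE mulrBl.
  by rewrite sumrB; ring.
have L_char m : L (div_char X m) = 0.
  apply: big1 => i _; rewrite mxE {1}(expand (ray i)) pairing_sumr.
  apply/eqP; rewrite subr_eq0; apply/eqP/eq_bigr => j _.
  by rewrite pairingZr mxE mulrC.
have L_mod D E : D = E %[mod Quotient.quot (@principal n X)] -> L D = L E.
  move=> /eqP; rewrite -Quotient.idealrBE => /asboolP[m DE].
  by apply/eqP; rewrite -subr_eq0 -LB DE L_char.
have l_additive : GRing.zmod_morphism (fun x : Pic X => L (repr x)).
  by move=> x y; rewrite -LB; apply: L_mod; rewrite reprK raddfB /= !reprK.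
pose l : {additive Pic X -> int} :=
  HB.pack (fun x : Pic X => L (repr x))
    (GRing.isZmodMorphism.Build _ _ _ l_additive).
exists l => x x_nef x_neq0; set D := repr x in x_nef.
pose m := - \sum_(j in s) D 0 j *: e j.
have pair_m u : pairing m u = - \sum_(j in s) D 0 j * pairing (e j) u.
  rewrite /m -scaleN1r pairingZl pairing_suml mulN1r; congr (- _).
  by apply: eq_bigr => j _; rewrite pairingZl.
have mD : {in s, forall i, pairing m (ray i) = - D 0 i}.
  move=> i si; rewrite pair_m (bigD1 i) //= e_dual // eqxx mulr1 big1 ?addr0 //.
  by move=> j /andP[sj ji]; rewrite e_dual // (negPf ji) mulr0.
have terms_ge0 i : 0 <= D 0 i - \sum_(j in s) D 0 j * pairing (e j) (ray i).
  have := nef_globally_generated X_smooth X_complete A_ample x_nef sX card_s mD i.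
  by rewrite pair_m lerN2 subr_ge0.
rewrite lt_def sumr_ge0 ?andbT; last by move=> i _; exact: terms_ge0.
apply/negP => /eqP /psumr_eq0P L0; apply: x_neq0.
rewrite -[x]reprK -[RHS](raddf0 (\pi_(Quotient.quot (@principal n X)))).
apply/eqP; rewrite -Quotient.idealrBE subr0; apply/asboolP; exists (- m).
apply/rowP => i; rewrite mxE -scaleN1r pairingZl pair_m mulN1r opprK.
by apply/eqP; rewrite -subr_eq0 -/D; apply/eqP/L0.
Qed.

End Degree.

(** * Rational relations in an abelian group *)

Section RationalRelations.
Variables (V : zmodType) (r : nat) (E : 'I_r -> V) (D : V).
Implicit Types a x y : 'I_r -> rat.

Lemma eq_tensor_degree (l : {additive V -> int}) a :
  eq_tensor_rat D a E -> (l D)%:~R = \sum_i a i * (l (E i))%:~R.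
Proof.
move=> [k [b [k_gt0 bE DE]]].
have k_neq0 : k%:R != 0 :> rat by rewrite pnatr_eq0 -lt0n.
apply: (mulfI k_neq0); rewrite mulr_natl -rmorphMn -raddfMn DE raddf_sum rmorph_sum.
rewrite mulr_sumr; apply: eq_bigr => i _.
by rewrite raddfMz -[_ *~ b i]mulrzr intz rmorphM /= bE mulrC mulrA.
Qed.

Lemma eq_tensor_affine x y t : eq_tensor_rat D x E -> eq_tensor_rat D y E ->
  eq_tensor_rat D (fun i => x i + t * (y i - x i)) E.
Proof.
move=> [k [b [k_gt0 bE DE]]] [k' [b' [k'_gt0 b'E DE']]].
pose d := `|denq t|%N.
have dE : d%:Z = denq t by rewrite absz_denq.
(* The product of the three denominators is a denominator of the result. *)
exists (k * k' * d)%N,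
  (fun i => b i * (k'%:Z * (denq t - numq t)) + b' i * (k%:Z * numq t)).
split=> [|i|].
- by rewrite !muln_gt0 k_gt0 k'_gt0 absz_gt0 denq_neq0.
- have dq : (denq t)%:~R != 0 :> rat by rewrite intr_eq0 denq_neq0.
  rewrite !natrM [d%:R]pmulrn dE !rmorphD !rmorphM rmorphB /= bE b'E.
  have : t = (numq t)%:~R / (denq t)%:~R by rewrite divq_num_den.
  move: dq; rewrite -!pmulrn.
  by move: (numq t)%:~R (denq t)%:~R => p q q_neq0 ->; field.
- under eq_bigr do rewrite mulrzDr !mulrzA.
  rewrite big_split /= -!mulrz_suml -DE -DE' !pmulrn -!mulrzA -mulrzDr.
  by congr (_ *~ _); rewrite !PoszM dE; ring.
Qed.

Lemma eq_tensor_substitute (N : nat) (h : 'I_N -> V) (w : 'I_r -> 'I_N -> nat) a :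
  (forall i, \sum_j h j *+ w i j = E i) -> eq_tensor_rat D a E ->
  eq_tensor_rat D (fun j => \sum_i a i * (w i j)%:R) h.
Proof.
move=> wE [k [b [k_gt0 bE DE]]].
exists k, (fun j => \sum_i b i * (w i j)%:Z); split=> // [j|].
  rewrite rmorph_sum mulr_sumr; apply: eq_bigr => i _.
  by rewrite rmorphM /= bE mulrA -pmulrn.
under [RHS]eq_bigr do rewrite mulrz_sumr.
rewrite exchange_big DE; apply: eq_bigr => i _.
rewrite -(wE i) mulrz_suml; apply: eq_bigr => j _.
by rewrite mulrC mulrzA -pmulrn.
Qed.

End RationalRelations.

(** * Decompositions over a Hilbert basis *)

Section HilbertBasis.
Variables (V : zmodType) (G : set V) (l : {additive V -> int}).
Hypothesis l_gt0 : forall x, G x -> x <> 0 -> 0 < l x.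
Variables (N : nat) (h : 'I_N -> V).
Hypothesis h_basis : range h = hilbert_basis G.

Lemma hilbert_basis_mem j : G (h j) /\ h j <> 0.
Proof.
have : range h (h j) by exists j.
by rewrite h_basis => -[].
Qed.

Lemma hilbert_degree_ge1 j : 1 <= l (h j).
Proof. by have [hG h0] := hilbert_basis_mem j; have := l_gt0 hG h0. Qed.

(** An element outside the Hilbert basis splits into two nonzero elements of [G],
    both of smaller degree. *)
Lemma hilbert_generates x : G x -> exists z : 'I_N -> nat, \sum_j h j *+ z j = x.
Proof.
have [k] := ubnP (absz (l x)); elim: k => // k IHk in x *; rewrite ltnS => le_k xG.
have [->|x_neq0] := pselect (x = 0).
  by exists (fun=> 0%N); rewrite big1.
have [[j _ <-]|x_dec] := pselect (range h x).
  exists (fun i => (i == j)%N); rewrite (bigD1 j) //= eqxx big1 ?addr0 //.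
  by move=> i /negPf->.
have [u [v [uG vG u0 v0 xE]]] : exists u v, [/\ G u, G v, u <> 0, v <> 0 & x = u + v].
  apply: contrapT => indec; apply: x_dec; rewrite h_basis; split=> // u v uG vG u0 v0 xE.
  by apply: indec; exists u, v.
have lx : l x = l u + l v by rewrite xE raddfD.
have [lu lv] := (l_gt0 uG u0, l_gt0 vG v0).
have [|z zE] := IHk u _ uG; first by lia.
have [|z' z'E] := IHk v _ vG; first by lia.
exists (fun j => z j + z' j)%N; rewrite xE -zE -z'E -big_split.
by apply: eq_bigr => j _; rewrite mulrnDr.
Qed.

Lemma nonzero_sum_gt0 x (z : 'I_N -> nat) :
  x <> 0 -> \sum_j h j *+ z j = x -> (0 < \sum_j z j)%N.
Proof.
move=> x_neq0 zE; rewrite lt0n; apply/eqP => /eqP; rewrite sum_nat_eq0 => /forallP z0.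
by apply: x_neq0; rewrite -zE big1 // => j _; have /eqP-> := z0 j.
Qed.

Section Refinement.
Variables (D : V) (r : nat) (E : 'I_r -> V).
Hypothesis E_nef : forall i, G (E i) /\ E i <> 0.

Lemma hilbert_expand : exists2 w : 'I_r -> 'I_N -> nat,
  (forall i, \sum_j h j *+ w i j = E i) & forall i, (0 < \sum_j w i j)%N.
Proof.
have [w wE] := choice (fun i => hilbert_generates (E_nef i).1).
by exists w => // i; exact: nonzero_sum_gt0 (E_nef i).2 (wE i).
Qed.

Lemma refine_int (a : 'I_r -> int) :
  (forall i, 0 < a i) -> D = \sum_i E i *~ a i ->
  exists2 z : 'I_N -> nat, \sum_j h j *+ z j = D &
    \sum_i a i <= (\sum_j z j)%N%:Z.
Proof.
move=> a_gt0 DE; have [w wE w_gt0] := hilbert_expand.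
have aE i : a i = (absz (a i))%:Z by rewrite gez0_abs // ltW.
exists (fun j => \sum_i absz (a i) * w i j)%N.
  under eq_bigr do rewrite -sumrMnr.
  rewrite exchange_big DE; apply: eq_bigr => i _.
  rewrite -(wE i) mulrz_suml; apply: eq_bigr => j _.
  by rewrite [a i]aE mulnC mulrnA -pmulrn.
rewrite exchange_big /= (big_morph Posz PoszD (erefl _)); apply: ler_sum => i _.
by rewrite {1}[a i]aE -big_distrr /= lez_nat leq_pmulr.
Qed.

Lemma refine_rat (a : 'I_r -> rat) :
  (forall i, 0 < a i) -> eq_tensor_rat D a E ->
  exists q : 'I_N -> rat,
    [/\ forall j, 0 <= q j, eq_tensor_rat D q h & \sum_i a i <= \sum_j q j].
Proof.
move=> a_gt0 DE; have [w wE w_gt0] := hilbert_expand.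
exists (fun j => \sum_i a i * (w i j)%:R); split.
- by move=> j; apply: sumr_ge0 => i _; rewrite mulr_ge0 // ltW.
- exact: eq_tensor_substitute DE.
- rewrite exchange_big /=; apply: ler_sum => i _.
  by rewrite -mulr_sumr -natr_sum ler_peMr ?ler1n // ltW.
Qed.

End Refinement.

Section Optimum.
Variable D : V.

(** Every generator has degree at least [1], so the number of generators used
    for [D] is at most [l D]. *)
Lemma hilbert_int_max : G D ->
  exists2 z : 'I_N -> nat, \sum_j h j *+ z j = D &
    forall z' : 'I_N -> nat, \sum_j h j *+ z' j = D ->
      (\sum_j z' j <= \sum_j z j)%N.
Proof.
move=> DG.
pose P k := `[< exists2 z : 'I_N -> nat, \sum_j h j *+ z j = D & k = (\sum_j z j)%N >].
have exP : exists k, P k.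
  have [z zE] := hilbert_generates DG.
  by exists (\sum_j z j)%N; apply/asboolP; exists z.
have ubP k : P k -> (k <= absz (l D))%N.
  move=> /asboolP[z zE ->]; rewrite -lez_nat.
  apply: le_trans (lez_abs _); rewrite -zE (big_morph Posz PoszD (erefl _)).
  rewrite raddf_sum; apply: ler_sum => j _.
  rewrite raddfMn /= -[X in X <= _]natz -[X in X <= _]mulr1 mulr_natl.
  by rewrite lerMn2r hilbert_degree_ge1 orbT.
have [_ /asboolP[z zE ->] zmax] := ex_maxnP exP ubP.
by exists z => // z' z'E; apply: zmax; apply/asboolP; exists z'.
Qed.

Definition feasible (q : 'I_N -> rat) : Prop :=
  (forall j, 0 <= q j) /\ eq_tensor_rat D q h.

Definition supp (q : 'I_N -> rat) : {set 'I_N} := [set j | q j != 0].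

(** The vertices of the polyhedron of feasible points: a face of it is cut out by
    the vanishing of some coordinates, and a vertex is the only point of the
    smallest face that contains it. *)
Definition vertex (q : 'I_N -> rat) : Prop :=
  feasible q /\ forall q', feasible q' -> supp q' \subset supp q -> q' = q.

(** The step of linear programming: a second feasible point on the same face
    gives a line through [q] in that face.  Follow it in the direction [u] that
    does not decrease the sum of the coordinates.  Pairing with the degree shows
    that [u] has a negative coordinate, so that one has to stop, and where one
    stops a further coordinate vanishes. *)
Lemma feasible_shrink q : feasible q -> ~ vertex q ->
  exists q', [/\ feasible q', supp q' \proper supp q & \sum_j q j <= \sum_j q' j].
Proof.
move=> q_feas q_nvertex; have [q_ge0 qD] := q_feas.
have [y y_feas [/fintype.subsetP y_supp y_neq]] :
    exists2 y, feasible y & supp y \subset supp q /\ y <> q.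
  apply: contrapT => noy; apply: q_nvertex; split=> // y y_feas y_supp.
  by apply: contrapT => y_neq; apply: noy; exists y.
have [_ yD] := y_feas.
have [u [u_sum u_supp [j0 uj0] u_affine]] : exists u : 'I_N -> rat,
    [/\ 0 <= \sum_j u j, forall j, q j = 0 -> u j = 0, exists j, u j < 0 &
        forall t, eq_tensor_rat D (fun j => q j + t * u j) h].
  have d_supp j : q j = 0 -> y j - q j = 0.
    move=> qj; rewrite qj subr0; apply/eqP; apply: contraT => yj.
    by have := y_supp j; rewrite !inE qj eqxx => /(_ yj).
  (* The coordinates of [y - q], weighted by positive degrees, sum to zero:
     they take both signs. *)
  have d_degree : \sum_j (y j - q j) * (l (h j))%:~R = 0.
    under eq_bigr do rewrite mulrBl.
    by rewrite sumrB -(eq_tensor_degree l yD) -(eq_tensor_degree l qD) subrr.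
  have signs (c : rat) : c != 0 -> exists j, c * (y j - q j) < 0.
    move=> c_neq0; apply: contrapT => /forallNP pos; apply: y_neq.
    have term_ge0 j : 0 <= c * (y j - q j) * (l (h j))%:~R.
      rewrite mulr_ge0 //; first by rewrite leNgt; exact/negP.
      by rewrite ler0z (le_trans _ (hilbert_degree_ge1 j)).
    have : \sum_j c * (y j - q j) * (l (h j))%:~R = 0.
      under eq_bigr do rewrite -mulrA.
      by rewrite -mulr_sumr d_degree mulr0.
    move/psumr_eq0P => term0; apply/funext => j; apply/eqP; rewrite -subr_eq0.
    have /eqP := term0 (fun j _ => term_ge0 j) j isT.
    rewrite !mulf_eq0 (negPf c_neq0) intr_eq0 /= => /orP[//|/eqP lj].
    by have := hilbert_degree_ge1 j; rewrite lj.
  have [d_sum|d_sum] := leP 0 (\sum_j (y j - q j)).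
    exists (fun j => y j - q j); split=> //; last first.
      by move=> t; exact: eq_tensor_affine.
    by have [j] := signs 1 (oner_neq0 _); rewrite mul1r; exists j.
  exists (fun j => - 1 * (y j - q j)); split.
  - by rewrite -mulr_sumr mulN1r oppr_ge0 ltW.
  - by move=> j /d_supp->; rewrite mulr0.
  - by apply: signs; rewrite oppr_eq0 oner_eq0.
  - move=> t; have := eq_tensor_affine (- t) qD yD.
    by under eq_fun do rewrite mulNr -mulrN -mulN1r.
(* [ratio j] is the time at which the coordinate [j] reaches zero. *)
pose ratio j := q j / - u j.
have [j1 uj1 ratio_min] := @arg_minP _ _ _ j0 (fun j => u j < 0) ratio uj0.
set t := ratio j1 in ratio_min.
have t_ge0 : 0 <= t by rewrite divr_ge0 // oppr_ge0 ltW.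
have qj1 : q j1 + t * u j1 = 0.
  by rewrite /t /ratio invrN mulrN mulNr divfK ?subrr // lt_eqF.
exists (fun j => q j + t * u j); split.
- split=> // j; have [uj|uj] := leP 0 (u j); first by rewrite addr_ge0 // mulr_ge0.
  have := ratio_min _ uj; rewrite ler_pdivlMr ?oppr_gt0 //.
  by rewrite mulrN -subr_ge0 opprK.
- apply/fintype.properP; split.
    apply/fintype.subsetP => j; rewrite !inE; apply: contraNneq => qj.
    by rewrite qj u_supp // mulr0 addr0.
  exists j1; rewrite !inE ?qj1 ?eqxx //.
  by apply: contraTneq uj1 => /u_supp->; rewrite ltxx.
- by rewrite big_split /= lerDl -mulr_sumr mulr_ge0.
Qed.

Lemma vertex_dominates q : feasible q ->
  exists2 v, vertex v & \sum_j q j <= \sum_j v j.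
Proof.
have [k] := ubnP #|supp q|; elim: k => // k IHk in q *; rewrite ltnS => le_k q_feas.
have [q_vertex|q_nvertex] := pselect (vertex q); first by exists q.
have [q' [q'_feas /proper_card lt_supp q_le]] := feasible_shrink q_feas q_nvertex.
have [v v_vertex q'_le] := IHk q' (leq_trans lt_supp le_k) q'_feas.
by exists v => //; exact: le_trans q'_le.
Qed.

(** A vertex is determined by its support, so the maximum can be taken over
    the finite set of supports of vertices. *)
Lemma hilbert_rat_max : G D ->
  exists2 q, feasible q & forall q', feasible q' -> \sum_j q' j <= \sum_j q j.
Proof.
move=> DG; have [z zE] := hilbert_generates DG.
have z_feas : feasible (fun j => (z j)%:R).
  split=> [j|]; first exact: ler0n.
  exists 1%N, (fun j => (z j)%:Z); split=> [//|j|]; first by rewrite mul1r -pmulrn.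
  by rewrite mulr1n -zE; apply: eq_bigr => j _; rewrite -pmulrn.
have [v0 v0_vertex _] := vertex_dominates z_feas.
pose P (S : {set 'I_N}) := `[< exists2 v, vertex v & supp v = S >].
pose pick (S : {set 'I_N}) : 'I_N -> rat :=
  xget (fun=> 0) (fun v => vertex v /\ supp v = S).
have pickP v : vertex v -> pick (supp v) = v.
  move=> v_vertex; rewrite /pick; case: xgetP => [_ -> [w_vertex wv]|/(_ v)[]//].
  by apply: v_vertex.2; [exact: w_vertex.1 | rewrite wv].
have P0 : P (supp v0) by apply/asboolP; exists v0.
have [S /asboolP[v v_vertex vS] vmax] :=
  @arg_maxP _ _ _ (supp v0) P (fun S => \sum_j pick S j) P0.
exists v; first exact: v_vertex.1.
move=> q q_feas; have [w w_vertex q_le] := vertex_dominates q_feas.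
apply: (le_trans q_le); have := vmax (supp w).
by rewrite -vS !pickP //; apply; apply/asboolP; exists w.
Qed.

End Optimum.
End HilbertBasis.

(** * Comparison of the two sides *)

(** Here [A] is the set of sums over the Hilbert basis and [B] the set of sums
    over arbitrary nef decompositions. *)
Lemma is_max_dominated (R : realType) (A B : set (\bar R)) x :
  is_max A x -> (A `<=` B)%classic -> (forall b, B b -> exists2 a, A a & (b <= a)%E) ->
  is_max A (ereal_sup B) /\ is_max B (ereal_sup B).
Proof.
move=> [Ax x_ub] AB dom.
have Bx : ubound B x.
  by move=> b /dom[a Aa ba]; apply: le_trans ba (x_ub a Aa).
have -> : ereal_sup B = x.
  apply/eqP; rewrite eq_le; apply/andP; split; first exact: ge_ereal_sup.
  by apply: ereal_sup_ubound; exact: AB.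
by split; split=> //; exact: AB.
Qed.

Lemma sum_over_support (W : nmodType) (N : nat) (S : {set 'I_N}) (F : 'I_N -> W) :
  (forall j, j \notin S -> F j = 0) ->
  \sum_j F j = \sum_(i < #|S|) F (enum_val i).
Proof.
move=> F0; rewrite -big_enum_val /= [RHS]big_mkcond; apply: eq_bigr => j _.
by case: ifPn => // /F0.
Qed.

Theorem proposition2p5 (R : realType) (n : nat) (X : fan n)
    (X_proj : smooth_projective X)
    (N : nat) (h : 'I_N -> Pic X) (h_inj : injective h)
    (h_basis : range h = hilbert_basis (@nef n X))
    (D : Pic X) (D_nef : nef D) (D_neq0 : D <> 0) :
  [/\ is_max (hilbert_int_set R D h) (tau_int R D),
      is_max (hilbert_rat_set R D h) (tau_rat R D),
      is_max (tau_int_set R D) (tau_int R D) &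
      is_max (tau_rat_set R D) (tau_rat R D)].
Proof.
have [l l_gt0] := nef_degree X_proj.
have h_nef := hilbert_basis_mem h_basis.
have [int_max tau_int_max] : is_max (hilbert_int_set R D h) (tau_int R D) /\
    is_max (tau_int_set R D) (tau_int R D).
  have [z zD z_max] := hilbert_int_max l_gt0 h_basis D_nef.
  apply: (@is_max_dominated _ _ _ (\sum_j z j)%N%:R%:E).
  - split; first by exists z.
    by move=> _ [z' [z'D ->]]; rewrite lee_fin ler_nat z_max.
  - move=> _ [z' [z'D ->]]; pose S := [set j | (0 < z' j)%N].
    exists #|S|, (fun i => (z' (enum_val i))%:Z), (fun i => h (enum_val i)).
    have z'0 j : j \notin S -> z' j = 0%N by rewrite inE -eqn0Ngt => /eqP.
    split=> //.
    + by move=> i; have := enum_valP i; rewrite inE.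
    + by rewrite -z'D (sum_over_support (S := S)) // => j /z'0->.
    + congr (_%:E).
      rewrite -(sum_over_support (F := fun j => (z' j)%:Z)) => [|j /z'0->] //.
      by rewrite natr_sum [RHS]rmorph_sum.
  - move=> _ [r [a [E [E_nef a_gt0 DE ->]]]].
    have [z' z'D le_z'] := refine_int l_gt0 h_basis E_nef a_gt0 DE.
    exists (\sum_j z' j)%N%:R%:E; first by exists z'.
    by rewrite lee_fin pmulrn ler_int.
have [rat_max tau_rat_max] : is_max (hilbert_rat_set R D h) (tau_rat R D) /\
    is_max (tau_rat_set R D) (tau_rat R D).
  have [q [q_ge0 qD] q_max] := hilbert_rat_max l_gt0 h_basis D_nef.
  apply: (@is_max_dominated _ _ _ (ratr (\sum_j q j))%:E).
  - split; first by exists q.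
    by move=> _ [q' [q'_ge0 q'D ->]]; rewrite lee_fin ler_rat; apply: q_max.
  - move=> _ [q' [q'_ge0 q'D ->]]; pose S := [set j | q' j != 0].
    exists #|S|, (fun i => q' (enum_val i)), (fun i => h (enum_val i)).
    have q'0 j : j \notin S -> q' j = 0 by rewrite inE negbK => /eqP.
    split=> //.
    + by move=> i; have := enum_valP i; rewrite inE lt_def q'_ge0 andbT.
    + have [k [b [k_gt0 bE DE]]] := q'D; exists k, (fun i => b (enum_val i)).
      split=> //; rewrite DE (sum_over_support (S := S)) // => j /q'0 q'j.
      have /eqP := bE j; rewrite q'j mulr0 intr_eq0 => /eqP->.
      by rewrite mulr0z.
    + by rewrite -(sum_over_support (F := q')).
  - move=> _ [r [a [E [E_nef a_gt0 DE ->]]]].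
    have [q' [q'_ge0 q'D le_q']] := refine_rat l_gt0 h_basis E_nef a_gt0 DE.
    exists (ratr (\sum_j q' j))%:E; first by exists q'.
    by rewrite lee_fin ler_rat.
by split.
Qed.
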